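(* Let $\mathcal{A}$ be a field of subsets of a nonempty set $X$, with $\mathcal{M}(X,\mathcal{A})$ regarded as a ring under pointwise operations (standing assumption: it is closed under pointwise addition and multiplication). For an order ideal $I$ of $\mathcal{A}$ let $\overline{I}=\{f\in\mathcal{M}(X,\mathcal{A}):\operatorname{coz}(f)\in I\}$. Then: (1) If $I$ is an order ideal of $\mathcal{A}$, then $\overline{I}$ is a ring ideal of $\mathcal{M}(X,\mathcal{A})$. (2) If $J$ is a ring ideal of $\mathcal{M}(X,\mathcal{A})$, there is a unique order ideal $\Theta(J)$ of $\mathcal{A}$ such that $J=\overline{\Theta(J)}$. (3) If $I$ and $K$ are order ideals of $\mathcal{A}$, then $I\subseteq K$ if and only if $\overline{I}\subseteq\overline{K}$. (4) An ideal $M$ of $\mathcal{M}(X,\mathcal{A})$ is a maximal ring ideal if and only if $\Theta(M)$ is a maximal order ideal. (5) An ideal $J$ of $\mathcal{M}(X,\mathcal{A})$ is a minimal ring ideal if and only if $\Theta(J)$ is a minimal order ideal, i.e., there is an atom $A$ of $\mathcal{A}$ such that $\Theta(J)=\{\emptyset,A\}$.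
   Context: A field of subsets of a nonempty set $X$ is a nonempty family $\mathcal{A}\subseteq\mathcal{P}(X)$ closed under finite unions and complements in $X$. $\mathcal{M}(X,\mathcal{A})=\{f:X\to\mathbb{R} : f^{-1}(U)\in\mathcal{A}\text{ for every open }U\subseteq\mathbb{R}\}$, with pointwise operations. $\operatorname{coz}(f)=\{x\in X:f(x)\ne 0\}$. An order ideal of $\mathcal{A}$ is a nonempty $I\subseteq\mathcal{A}$ such that $B\in\mathcal{A}$, $B\subseteq A\in I$ imply $B\in I$, and $A,B\in I$ imply $A\cup B\in I$. Maximal ideals are maximal among proper ideals (an order ideal is proper if $X\notin I$), and minimal ideals are minimal among nonzero ideals (for order ideals: ideals different from $\{\emptyset\}$). An atom of $\mathcal{A}$ is a nonempty $A\in\mathcal{A}$ such that every nonempty $C\in\mathcal{A}$ with $C\subseteq A$ equals $A$. *)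

(* Defs.v *)
From HB Require Import structures.
From mathcomp Require Import all_boot all_order all_algebra.
From mathcomp Require Import all_classical all_reals all_analysis.
Set Implicit Arguments.
Unset Strict Implicit.
Unset Printing Implicit Defensive.
Import Order.TTheory GRing.Theory Num.Theory.
Import numFieldNormedType.Exports.
Local Open Scope classical_set_scope.
Local Open Scope ring_scope.

Definition field_of_subsets (X : Type) (A : set (set X)) : Prop :=
  [/\ A !=set0, setU_closed A & setC_closed A].

Definition atom (X : Type) (A : set (set X)) (B : set X) : Prop :=
  [/\ A B, B !=set0 & forall C, A C -> C !=set0 -> C `<=` B -> C = B].

Definition order_ideal (X : Type) (A I : set (set X)) : Prop :=
  [/\ I !=set0, I `<=` A,
      (forall B C, A B -> I C -> B `<=` C -> I B) & setU_closed I].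

Definition maximal_order_ideal (X : Type) (A I : set (set X)) : Prop :=
  [/\ order_ideal A I, ~ I setT &
      forall K, order_ideal A K -> ~ K setT -> I `<=` K -> K = I].

Definition minimal_order_ideal (X : Type) (A I : set (set X)) : Prop :=
  [/\ order_ideal A I, I <> [set set0] &
      forall K, order_ideal A K -> K <> [set set0] -> K `<=` I -> K = I].

(* MathComp's idealr_closed only covers proper ideals of nontrivial rings. *)
Definition ring_ideal (S : comPzRingType) (J : set S) : Prop :=
  [/\ J 0, (forall f g, J f -> J g -> J (f + g)) &
      forall h f, J f -> J (h * f)].

Definition maximal_ring_ideal (S : comPzRingType) (J : set S) : Prop :=
  [/\ ring_ideal J, J <> setT &
      forall K, ring_ideal K -> K <> setT -> J `<=` K -> K = J].

Definition minimal_ring_ideal (S : comPzRingType) (J : set S) : Prop :=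
  [/\ ring_ideal J, J <> [set 0] &
      forall K, ring_ideal K -> K <> [set 0] -> K `<=` J -> K = J].

Definition coz (R : realType) (X : Type) (f : X -> R) : set X :=
  [set x | f x != 0].

Definition Mfun (R : realType) (X : Type) (A : set (set X)) : set (X -> R) :=
  [set f | forall U : set R, open U -> A (f @^-1` U)].

Section ring_of_functions.
Context (R : realType) (X : Type) (A : set (set X)).
Context (hA : field_of_subsets A).
Context (hD : forall f g : X -> R, Mfun A f -> Mfun A g -> Mfun A (f + g)).
Context (hM : forall f g : X -> R, Mfun A f -> Mfun A g -> Mfun A (f * g)).

(* The proofs are phantom arguments of the predicate, so that the subring
   instance below can be inferred from it. *)
Definition Mpred of field_of_subsets A
    & (forall f g : X -> R, Mfun A f -> Mfun A g -> Mfun A (f + g))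
    & (forall f g : X -> R, Mfun A f -> Mfun A g -> Mfun A (f * g)) :
    {pred X -> R} :=
  mem (Mfun A).

Lemma Mfun_cst (c : R) : Mfun A (fun=> c).
Proof.
have [[B AB] AU AC] := hA.
have A1 : A setT by rewrite -(setUv B); apply: AU => //; apply: AC.
have A0 : A set0 by rewrite -setCT; apply: AC.
move=> U _; have [Uc|nUc] := pselect (U c).
  by rewrite (_ : _ @^-1` U = setT)//; apply/seteqP; split.
by rewrite (_ : _ @^-1` U = set0)//; apply/seteqP; split.
Qed.

Lemma Mpred_subring_closed : subring_closed (Mpred hA hD hM).
Proof.
split=> [|f g|f g]; rewrite !inE /=.
- exact: Mfun_cst.
- move=> Mf Mg; apply: hD => //.
  rewrite (_ : - g = (fun=> -1) * g); first exact: hM (Mfun_cst _) Mg.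
  by apply/funext => x /=; rewrite mulrfctE opprfctE mulN1r.
- exact: hM.
Qed.

HB.instance Definition _ :=
  GRing.isSubringClosed.Build _ (Mpred hA hD hM) Mpred_subring_closed.

(* The ring M(X, A), as a subring of the ring of all functions X -> R. *)
Record Mring := MkMring {
  Mring_fun :> X -> R;
  _ : Mring_fun \in Mpred hA hD hM }.

HB.instance Definition _ := [isSub for Mring_fun].
HB.instance Definition _ := [Choice of Mring by <:].
HB.instance Definition _ :=
  GRing.SubChoice_isSubComPzRing.Build _ _ Mring Mpred_subring_closed.

Definition ideal_bar (I : set (set X)) : set Mring :=
  [set f | I (coz f)].

(* The unique order ideal I with J = ideal_bar I; the default value of `get` is
   irrelevant when J is a ring ideal. *)
Definition Theta (J : set Mring) : set (set X) :=
  get (fun I => order_ideal A I /\ J = ideal_bar I).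

End ring_of_functions.

Arguments ideal_bar {R X A} hA hD hM I.

(* Main.v *)
Require Import Defs.
From HB Require Import structures.
From mathcomp Require Import all_boot all_order all_algebra.
From mathcomp Require Import all_classical all_reals all_analysis.
Set Implicit Arguments.
Unset Strict Implicit.
Unset Printing Implicit Defensive.
Import Order.TTheory GRing.Theory Num.Theory.
Import numFieldNormedType.Exports.
Local Open Scope classical_set_scope.
Local Open Scope ring_scope.

(** The cozero set of a function carries all the ideal-theoretic information
    about it. Every $B \in \mathcal A$ is the cozero set of its indicator
    function, so $I \mapsto \overline I$ reflects inclusions and is injective.
    For surjectivity, let $J$ be a ring ideal and $I$ the family of cozero sets
    of its members. Multiplying by an indicator cuts a cozero set down to any
    smaller member of $\mathcal A$, and
    $\mathrm{coz}(f) \cup \mathrm{coz}(g) = \mathrm{coz}(f^2 + g^2)$,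
    so $I$ is an order ideal ([order_ideal_coz]). The ring contains the
    pointwise inverse $g^{-1}$, extended by $0$, of each of its members
    ([Mfun_inv]); so if $\mathrm{coz}(f) \subseteq \mathrm{coz}(g)$ with
    $g \in J$, then $f = f g^{-1} g \in J$ ([ring_ideal_coz]), and hence
    $J = \overline I$.

    Thus $I \mapsto \overline I$ is an isomorphism of posets from order ideals
    to ring ideals, with inverse $\Theta$. It matches the zero ideals and the
    improper ideals on both sides ([ideal_bar_eq0], [ideal_barT]), so it matches
    the minimal and the maximal ideals too. Finally, a minimal order ideal is
    generated by any of its nonempty members, which forces it to be
    $\{\emptyset, B\}$ with $B$ an atom ([minimal_order_idealP]). *)

(** * Cozero sets and measurable functions *)

Section functions.
Context (R : realType) (X : Type).
Implicit Types f g : X -> R.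

Lemma coz0 : coz (0 : X -> R) = set0.
Proof. by rewrite -subset0 => x; rewrite /coz /= eqxx. Qed.

Lemma coz1 : coz (1 : X -> R) = setT.
Proof. by rewrite -subTset => x _; rewrite /coz /= oner_neq0. Qed.

Lemma coz_eq0 f : coz f = set0 -> f = 0.
Proof.
move=> f0; apply/funext => x; apply/eqP; apply: contraT => fx.
by have : coz f x by []; rewrite f0.
Qed.

Lemma cozM f g : coz (f * g) = coz f `&` coz g.
Proof.
by apply/seteqP; split=> x; rewrite /coz /= mulf_eq0 negb_or => /andP.
Qed.

Lemma cozD_sub f g : coz (f + g) `<=` coz f `|` coz g.
Proof.
move=> x; rewrite /coz /= => fg; have [f0|] := eqVneq (f x) 0; last by left.
by right; move: fg; rewrite /GRing.add /= f0 add0r.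
Qed.

(** Over the reals a sum of squares vanishes only where every term does. *)
Lemma coz_sum_squares f g : coz (f * f + g * g) = coz f `|` coz g.
Proof.
apply/seteqP; split=> x.
  by move=> /cozD_sub; rewrite !cozM !setIid.
rewrite /coz /= => fg.
have -> : (f * f + g * g) x = f x ^+ 2 + g x ^+ 2 by rewrite !expr2.
rewrite paddr_eq0 ?sqr_ge0// !sqrf_eq0 negb_and.
by case: fg => ->; rewrite ?orbT.
Qed.

Lemma coz_indic (B : set X) : coz (\1_B : X -> R) = B.
Proof.
apply/seteqP; split=> x; rewrite /coz /= indicE.
  by have [/set_mem//|_] := boolP (x \in B); rewrite eqxx.
by move=> Bx; rewrite mem_set//= oner_neq0.
Qed.

Context (A : set (set X)).
Context (hA : field_of_subsets A).

Lemma field_set0 : A set0.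
Proof.
have [[B AB] AU AC] := hA.
by rewrite -setCT -(setUv B); apply/AC/AU => //; apply: AC.
Qed.

Lemma Mfun_coz f : Mfun A f -> A (coz f).
Proof. by move=> Mf; exact: Mf (@open_neq R 0). Qed.

Lemma Mfun_indic B : A B -> Mfun A (\1_B : X -> R).
Proof.
have [_ AU AC] := hA => AB U _; rewrite preimage_indic.
by do 2 case: ifP => _ => //; [rewrite -(setUv B); apply: AU => //; apply: AC
  | exact: AC | exact: field_set0].
Qed.

(** Since $0^{-1} = 0$ by convention, the preimage of $U$ under the pointwise
    inverse splits into the preimage under $f$ of the open set
    $\{y \neq 0 : y^{-1} \in U\}$ and, when $0 \in U$, the zero set of $f$. *)
Lemma Mfun_inv f : Mfun A f -> Mfun A (fun x => (f x)^-1).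
Proof.
have [_ AU AC] := hA => Mf U oU.
have AV : A (f @^-1` [set y | y != 0 /\ U y^-1]).
  apply: Mf; rewrite openE => y [y0 Uy].
  have oy : \forall z \near y, z != 0.
    by apply: open_nbhs_nbhs; split=> //; exact: open_neq.
  have Uinv : \forall z \near y, U z^-1.
    by apply: (inv_continuous y0); exact: open_nbhs_nbhs.
  by near=> z; split; near: z.
have [U0|U0] := pselect (U 0).
  rewrite (_ : _ @^-1` U = f @^-1` [set y | y != 0 /\ U y^-1] `|` ~` coz f).
    by apply: AU => //; apply/AC/Mfun_coz.
  apply/seteqP; split=> x /=; rewrite /coz /=.
    by have [fx|fx] := eqVneq (f x) 0; [right | left].
  by move=> [[]//|/negP]; rewrite negbK => /eqP ->; rewrite invr0.
rewrite (_ : _ @^-1` U = f @^-1` [set y | y != 0 /\ U y^-1])//.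
apply/seteqP; split=> x /= => [Ux|[]//]; split=> //.
by apply: contra_notN U0 => /eqP fx; move: Ux; rewrite fx invr0.
Unshelve. all: by end_near. Qed.

End functions.

(** * Order ideals *)

Section order_ideals.
Context (X : Type) (A : set (set X)).
Context (hA : field_of_subsets A).

Lemma order_ideal_set0 I : order_ideal A I -> I set0.
Proof.
by move=> [[B IB] _ Idown _]; apply: Idown IB _ => //; exact: field_set0.
Qed.

Lemma order_ideal0 : order_ideal A [set set0].
Proof.
split; first by exists set0.
- by move=> _ ->; exact: field_set0.
- by move=> B _ _ ->; rewrite subset0.
- by move=> _ _ -> ->; rewrite setU0.
Qed.

Definition principal_order_ideal (B : set X) : set (set X) :=
  [set C | A C /\ C `<=` B].

Lemma principal_order_idealP B : order_ideal A (principal_order_ideal B).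
Proof.
have [_ AU _] := hA; split.
- by exists set0; split; [exact: field_set0|exact: sub0set].
- by move=> C [].
- by move=> C D AC [_ DB] CD; split=> //; exact: subset_trans CD DB.
- by move=> C D [AC CB] [AD DB]; split; [exact: AU|rewrite subUset].
Qed.

Lemma principal_order_ideal_neq0 B :
  A B -> B !=set0 -> principal_order_ideal B <> [set set0].
Proof.
move=> AB [x Bx] PB; have : [set set0] B by rewrite -PB; split.
by move=> B0; move: Bx; rewrite B0.
Qed.

(** A minimal order ideal is the principal ideal of each of its nonempty
    members, so any two nonempty members contain one another. *)
Lemma minimal_order_idealP I : order_ideal A I ->
  minimal_order_ideal A I <-> exists B, atom A B /\ I = [set set0; B].
Proof.
move=> oI; have I0 := order_ideal_set0 oI; split.
  move=> [[_ IA Idown _] In0 minI].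
  have [B IB B0] : exists2 B, I B & B !=set0.
    apply: contrapT => nB; apply: In0; apply/seteqP; split=> [B IB|_ -> //].
    by apply: contrapT => /eqP/set0P B0; apply: nB; exists B.
  have princ C : I C -> C !=set0 -> principal_order_ideal C = I.
    move=> IC C0; apply: minI; first exact: principal_order_idealP.
      by apply: principal_order_ideal_neq0 => //; exact: IA.
    by move=> D [AD DC]; exact: Idown IC DC.
  have least C : I C -> C !=set0 -> B `<=` C.
    by move=> IC C0; move: IB; rewrite -(princ C IC C0) => -[].
  exists B; split.
    split=> // [|C AC C0 CB]; first exact: IA.
    by apply/seteqP; split=> //; apply: least => //; exact: Idown IB CB.
  apply/seteqP; split=> [C IC|C [->|->]//].
  have [->|/set0P C0] := eqVneq C set0; [by left|right].
  apply/seteqP; split; last exact: least.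
  by move: IC; rewrite -(princ B IB B0) => -[].
move=> [B [[AB [x Bx] _] IE]]; split=> //.
  move=> I1; have : I B by rewrite IE; right.
  by rewrite I1 => B0; move: Bx; rewrite B0.
move=> K oK Kn0 KI; have K0 := order_ideal_set0 oK.
apply/seteqP; split=> // C; rewrite IE => -[->//|->].
apply: contrapT => nKB; apply: Kn0; apply/seteqP; split=> [D KD|_ ->//].
by have := KI _ KD; rewrite IE => -[//|DB]; rewrite DB in KD.
Qed.

End order_ideals.

(** * The correspondence between order ideals and ring ideals *)

Section ideal_correspondence.
Context (R : realType) (X : Type) (A : set (set X)).
Context (hA : field_of_subsets A).
Context (hD : forall f g : X -> R, Mfun A f -> Mfun A g -> Mfun A (f + g)).
Context (hM : forall f g : X -> R, Mfun A f -> Mfun A g -> Mfun A (f * g)).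
Local Notation M := (Mring hA hD hM).
Local Notation bar := (ideal_bar hA hD hM).
Implicit Types (I K : set (set X)) (J : set M).

Lemma Mring_of (f : X -> R) : Mfun A f -> exists g : M, Mring_fun g = f.
Proof.
move=> Mf; have Pf : f \in Mpred hA hD hM by rewrite inE.
by exists (MkMring Pf).
Qed.

Lemma Mring_Mfun (f : M) : Mfun A f.
Proof. by case: f => f /=; rewrite inE. Qed.

Lemma Mring_coz (f : M) : A (coz f).
Proof. exact: Mfun_coz (Mring_Mfun f). Qed.

Lemma Mring_indic B : A B -> exists g : M, coz g = B.
Proof.
move=> AB; have [g gE] := Mring_of (Mfun_indic hA AB).
by exists g; rewrite gE coz_indic.
Qed.

Lemma ring_ideal_bar I : order_ideal A I -> ring_ideal (bar I).
Proof.
move=> oI; have [_ _ Idown IU] := oI; split.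
- by rewrite /ideal_bar /= coz0; exact: order_ideal_set0 oI.
- move=> f g If Ig; apply: Idown (Mring_coz _) (IU _ _ If Ig) _.
  exact: cozD_sub.
- move=> h f If; apply: Idown (Mring_coz _) If _.
  by rewrite cozM; exact: subIsetr.
Qed.

(** The inclusion is reflected because every member of the field is a cozero
    set, namely that of its indicator function. *)
Lemma ideal_bar_subset I K : order_ideal A I -> order_ideal A K ->
  I `<=` K <-> bar I `<=` bar K.
Proof.
move=> [_ IA _ _] _; split=> [IK f If|IK B IB]; first exact: IK.
have [g gB] := Mring_indic (IA _ IB).
by have := IK g; rewrite /ideal_bar /= gB; apply.
Qed.

Lemma ideal_bar_inj I K : order_ideal A I -> order_ideal A K ->
  bar I = bar K -> I = K.
Proof.
move=> oI oK IK; apply/seteqP.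
by split; apply/ideal_bar_subset => //; rewrite IK.
Qed.

(** If $\mathrm{coz} f \subseteq \mathrm{coz} g$ then $f = f g^{-1} g$, where
    $g^{-1}$ is the pointwise inverse, extended by $0$. *)
Lemma ring_ideal_coz J (f g : M) :
  ring_ideal J -> J g -> coz f `<=` coz g -> J f.
Proof.
move=> [_ _ JM] Jg fg; have [h hE] := Mring_of (Mfun_inv hA (Mring_Mfun g)).
suff -> : f = f * h * g by exact: JM.
apply: val_inj; apply/funext => x /=.
rewrite -[RHS]/(f x * h x * g x) hE /= -mulrA.
have [fx|fx] := eqVneq (f x) 0; first by rewrite fx mul0r.
by rewrite mulVf ?mulr1//; exact: fg.
Qed.

Lemma order_ideal_coz J : ring_ideal J ->
  order_ideal A [set coz (Mring_fun f) | f in J].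
Proof.
move=> [J0 JD JM]; split.
- by exists (coz (Mring_fun (0 : M))); exists 0.
- by move=> _ [f _ <-]; exact: Mring_coz.
- move=> B _ AB [f Jf <-] Bf; have [g gB] := Mring_indic AB.
  by exists (g * f); [exact: JM|rewrite cozM gB; exact/setIidl].
- move=> _ _ [f Jf <-] [g Jg <-]; exists (f * f + g * g).
    by apply: JD; exact: JM.
  exact: coz_sum_squares.
Qed.

Lemma ideal_bar_surj J : ring_ideal J ->
  exists2 I, order_ideal A I & J = bar I.
Proof.
move=> rJ; exists [set coz (Mring_fun f) | f in J].
  exact: order_ideal_coz.
apply/seteqP; split=> [f Jf|f [g Jg gf]]; first by exists f.
by apply: ring_ideal_coz Jg _ => //; rewrite gf.
Qed.

Lemma ThetaP J : ring_ideal J -> order_ideal A (Theta J) /\ J = bar (Theta J).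
Proof.
move=> /ideal_bar_surj[I oI JI].
by apply: (@getPex _ (fun I => order_ideal A I /\ J = bar I)); exists I.
Qed.

Lemma ideal_barT I : order_ideal A I -> bar I = setT <-> I setT.
Proof.
move=> [_ _ Idown _]; split=> [IT|IT].
  have : bar I (1 : M) by rewrite IT.
  by rewrite /ideal_bar /= -[coz _]/(coz (1 : X -> R)) coz1.
by rewrite -subTset => f _; exact: Idown (Mring_coz f) IT _.
Qed.

Lemma ideal_bar0 : bar [set set0] = [set 0].
Proof.
apply/seteqP; split=> f; last by move=> ->; exact: coz0.
by move=> f0; apply: val_inj; exact: coz_eq0.
Qed.

Lemma ideal_bar_eq0 I : order_ideal A I -> bar I = [set 0] <-> I = [set set0].
Proof.
move=> oI; split=> [|->]; last exact: ideal_bar0.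
by rewrite -ideal_bar0; apply: ideal_bar_inj => //; exact: order_ideal0.
Qed.

Lemma maximal_ideal_bar I : order_ideal A I ->
  maximal_ring_ideal (bar I) <-> maximal_order_ideal A I.
Proof.
move=> oI; split=> -[_ IT maxI]; split=> //.
- by move/(ideal_barT oI).
- move=> K oK KT IK; apply: ideal_bar_inj => //.
  apply: maxI; [exact: ring_ideal_bar|by move/(ideal_barT oK)|].
  exact/ideal_bar_subset.
- exact: ring_ideal_bar.
- by move/(ideal_barT oI).
- move=> _ /ideal_bar_surj[K oK ->] KT /(ideal_bar_subset oI oK) IK.
  by congr bar; apply: maxI => // /(ideal_barT oK).
Qed.

Lemma minimal_ideal_bar I : order_ideal A I ->
  minimal_ring_ideal (bar I) <-> minimal_order_ideal A I.
Proof.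
move=> oI; split=> -[_ I0 minI]; split=> //.
- by move/(ideal_bar_eq0 oI).
- move=> K oK K0 KI; apply: ideal_bar_inj => //.
  apply: minI; [exact: ring_ideal_bar|by move/(ideal_bar_eq0 oK)|].
  exact/ideal_bar_subset.
- exact: ring_ideal_bar.
- by move/(ideal_bar_eq0 oI).
- move=> _ /ideal_bar_surj[K oK ->] K0 /(ideal_bar_subset oK oI) KI.
  by congr bar; apply: minI => // /(ideal_bar_eq0 oK).
Qed.

End ideal_correspondence.

Theorem proposition2p2 (R : realType) (X : Type) (hX : [set: X] !=set0)
    (A : set (set X)) (hA : field_of_subsets A)
    (hD : forall f g : X -> R, Mfun A f -> Mfun A g -> Mfun A (f + g))
    (hM : forall f g : X -> R, Mfun A f -> Mfun A g -> Mfun A (f * g)) :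
  (* (1) *)
  (forall I : set (set X), order_ideal A I ->
     ring_ideal (ideal_bar hA hD hM I)) /\
  (* (2) *)
  (forall J : set (Mring hA hD hM), ring_ideal J ->
     (exists! I : set (set X),
        order_ideal A I /\ J = ideal_bar hA hD hM I) /\
     (order_ideal A (Theta J) /\ J = ideal_bar hA hD hM (Theta J))) /\
  (* (3) *)
  (forall I K : set (set X), order_ideal A I -> order_ideal A K ->
     (I `<=` K <-> ideal_bar hA hD hM I `<=` ideal_bar hA hD hM K)) /\
  (* (4) *)
  (forall J : set (Mring hA hD hM), ring_ideal J ->
     (maximal_ring_ideal J <-> maximal_order_ideal A (Theta J))) /\
  (* (5) *)
  (forall J : set (Mring hA hD hM), ring_ideal J ->
     (minimal_ring_ideal J <-> minimal_order_ideal A (Theta J)) /\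
     (minimal_order_ideal A (Theta J) <->
      exists B : set X, atom A B /\ Theta J = [set set0; B])).
Proof.
split; first exact: ring_ideal_bar.
split.
  move=> J rJ; have [oT JT] := ThetaP rJ; split=> //.
  exists (Theta J); split=> // I [oI JI].
  by apply: (ideal_bar_inj (hA := hA) (hD := hD) (hM := hM)); rewrite -?JT.
split; first exact: ideal_bar_subset.
split=> J rJ; have [oT JT] := ThetaP rJ.
  by rewrite [X in maximal_ring_ideal X]JT; exact: maximal_ideal_bar.
split; last exact: minimal_order_idealP.
by rewrite [X in minimal_ring_ideal X]JT; exact: minimal_ideal_bar.
Qed.
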